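(* Let $\Bbbk$ be a field of characteristic zero, $U,U'$ finite-dimensional $\Bbbk$-vector spaces. For arbitrary finite-dimensional graded submodules $W\subset\mathcal Z^2(U)$ and $W'\subset\mathcal Z^2(U')$, with $\mathfrak g_W=M(U)/W^\perp$ and $\mathfrak g_{W'}=M(U')/W'^\perp$, the following are equivalent: (i) $\mathfrak g_W$ and $\mathfrak g_{W'}$ are isomorphic as Lie algebras; (ii) they are isomorphic as graded Lie algebras; (iii) there is a linear isomorphism $P:U\to U'$ whose restricted-dual pullback satisfies $P^*W'=W$.
   Context: $M(U)=\operatorname{Lie}(U)/\operatorname{Lie}(U)''$ is the free metabelian Lie algebra, graded with $U$ in degree one; $B(U)=M(U)'$ is an abelian ideal and a graded module over $R=\operatorname{Sym}(U)$ via $u\cdot b=[u,b]$, with $[u,v]$ ($u,v\in U$) in internal degree $0$ (Lie degree $2$). $\mathcal Z^2(U)=B(U)^\circ=\bigoplus_rB(U)_r^*$ is its restricted graded dual with contraction action $\langle b,p\circ\Phi\rangle=\langle pb,\Phi\rangle$, $p\in R$. A graded submodule is a graded subspace stable under this action; $W^\perp\subset B(U)$ is the annihilator of $W$, an $R$-submodule and hence an ideal of $M(U)$. A linear isomorphism $P:U\to U'$ induces $B(U)\to B(U')$ and its degreewise transpose $P^*:\mathcal Z^2(U')\to\mathcal Z^2(U)$, the restricted-dual pullback. *)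

(* Defs.v *)
From HB Require Import structures.
From mathcomp Require Export all_boot all_order all_algebra.
From mathcomp.multinomials Require Import ssrcomplements.
From mathcomp Require Export mpoly.
From mathcomp Require Export boolp classical_sets functions.

Set Implicit Arguments.
Unset Strict Implicit.
Unset Printing Implicit Defensive.

Import GRing.Theory.
Local Open Scope ring_scope.
Local Open Scope classical_set_scope.

Record submodule (k : fieldType) (V : lmodType k) := Submodule {
  sub_set :> V -> Prop;
  sub0 : sub_set 0;
  sub_lin : forall a x y, sub_set x -> sub_set y -> sub_set (a *: x + y)
}.

Section Submodule.
Variables (k : fieldType) (V : lmodType k) (S : submodule V).

Lemma subD x y : S x -> S y -> S (x + y).
Proof. by move=> Sx Sy; rewrite -[x]scale1r; apply: sub_lin. Qed.

Lemma subZ a x : S x -> S (a *: x).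
Proof. by move=> Sx; rewrite -[_ *: _]addr0; apply: sub_lin => //; apply: sub0. Qed.

Lemma subN x : S x -> S (- x).
Proof. by move=> Sx; rewrite -scaleN1r; apply: subZ. Qed.

Lemma subB x y : S x -> S y -> S (x - y).
Proof. by move=> Sx Sy; apply: subD => //; apply: subN. Qed.

Lemma sub_sum I (r : seq I) (F : I -> V) :
  (forall i, S (F i)) -> S (\sum_(i <- r) F i).
Proof.
by move=> SF; elim/big_rec: _ => [|i x _]; [apply: sub0 | apply: subD].
Qed.

Definition sub_pred : pred V := fun x => `[< S x >].

Lemma sub_predP x : reflect (S x) (sub_pred x).
Proof. exact: asboolP. Qed.

Lemma sub_pred_closed : submod_closed sub_pred.
Proof.
split; first by apply/sub_predP; apply: sub0.
by move=> a x y /sub_predP Sx /sub_predP Sy; apply/sub_predP; apply: sub_lin.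
Qed.

HB.instance Definition _ := GRing.isSubmodClosed.Build k V sub_pred sub_pred_closed.

Record subspace := Subspace { sub_val :> V; _ : sub_val \in sub_pred }.

HB.instance Definition _ := [isSub for sub_val].
HB.instance Definition _ := [Choice of subspace by <:].
HB.instance Definition _ := [SubChoice_isSubLmodule of subspace by <:].

Lemma sub_valP (x : subspace) : S (sub_val x).
Proof. exact/sub_predP/(valP x). Qed.

Definition to_sub x (Sx : S x) : subspace :=
  Subspace (introT (sub_predP x) Sx).

Definition quot_space := @Quotient.quot V (GRing.ZmodClosed.clone V sub_pred _).
HB.instance Definition _ := GRing.Zmodule.on quot_space.
HB.instance Definition _ := EqQuotient.on quot_space.

Definition qpi (x : V) : quot_space := (\pi_quot_space x)%qT.

Lemma qpi_eq x y : qpi x = qpi y <-> S (x - y).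
Proof.
have E := Quotient.idealrBE (GRing.ZmodClosed.clone V sub_pred _) x y.
split=> [H|/sub_predP H].
  by apply/sub_predP; change (x - y \in sub_pred); rewrite E; apply/eqP.
by apply/eqP; rewrite -E.
Qed.

Lemma qpi_surj (q : quot_space) : exists x, q = qpi x.
Proof. by exists (repr q); rewrite /qpi reprK. Qed.

Lemma qpiD x y : qpi (x + y) = qpi x + qpi y.
Proof. by rewrite /qpi (Quotient.pi_add _ x y). Qed.

Definition qscale (a : k) (q : quot_space) : quot_space := qpi (a *: repr q).

Lemma qscale_pi a x : qscale a (qpi x) = qpi (a *: x).
Proof.
apply/qpi_eq; rewrite -scalerBr; apply: subZ.
by apply/qpi_eq; rewrite /qpi reprK.
Qed.

Fact qscaleA a b v : qscale a (qscale b v) = qscale (a * b) v.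
Proof. by case: (qpi_surj v) => x ->; rewrite !qscale_pi scalerA. Qed.
Fact qscale1 : left_id 1 qscale.
Proof. by move=> v; case: (qpi_surj v) => x ->; rewrite qscale_pi scale1r. Qed.
Fact qscaleDr : right_distributive qscale +%R.
Proof.
move=> a v w; case: (qpi_surj v) => x ->; case: (qpi_surj w) => y ->.
by rewrite -qpiD !qscale_pi scalerDr qpiD.
Qed.
Fact qscaleDl v : {morph qscale^~ v : a b / a + b}.
Proof.
by move=> a b /=; case: (qpi_surj v) => x ->; rewrite !qscale_pi scalerDl qpiD.
Qed.
HB.instance Definition _ :=
  GRing.Zmodule_isLmodule.Build k quot_space qscaleA qscale1 qscaleDr qscaleDl.

Fact qpi_is_linear : linear qpi.
Proof. by move=> a x y; rewrite qpiD -qscale_pi. Qed.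
HB.instance Definition _ := GRing.isLinear.Build k V quot_space _ qpi qpi_is_linear.

End Submodule.

Arguments qpi {k V} S x.

Inductive span_of (k : fieldType) (V : lmodType k) (A : set V) : set V :=
| span_of0 : span_of A 0
| span_of_lin a x y : A x -> span_of A y -> span_of A (a *: x + y).

Section Span.
Variables (k : fieldType) (V : lmodType k) (A : set V).

Lemma span_of_closed a x y : span_of A x -> span_of A y -> span_of A (a *: x + y).
Proof.
move=> Ax Ay; elim: Ax => [|b u v Au _ IH]; first by rewrite scaler0 add0r.
by rewrite scalerDr -addrA scalerA; apply: span_of_lin.
Qed.

Definition lin_span := Submodule (span_of0 A) span_of_closed.

Lemma mem_lin_span x : A x -> lin_span x.
Proof. by move=> Ax; rewrite -[x]scale1r -[_ *: _]addr0; do !constructor. Qed.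

End Span.

Lemma lin_span_ind (k : fieldType) (V : lmodType k) (A : set V) (S : submodule V) :
  A `<=` S -> lin_span A `<=` S.
Proof.
move=> AS x; elim=> [|a u v Au _ Sv]; first exact: sub0.
by apply: sub_lin => //; apply: AS.
Qed.

Definition finite_dimensional (k : fieldType) (V : lmodType k) (S : submodule V) :=
  exists s : seq V, S = lin_span [set` s] :> set V.

HB.mixin Record Lmodule_isLie (k : fieldType) V of GRing.Lmodule k V := {
  bracket : V -> V -> V;
  bracket_linearl : forall a x y z,
    bracket (a *: x + y) z = a *: bracket x z + bracket y z;
  bracket_linearr : forall a x y z,
    bracket z (a *: x + y) = a *: bracket z x + bracket z y;
  bracketxx : forall x, bracket x x = 0;
  jacobi : forall x y z,
    bracket x (bracket y z) + bracket y (bracket z x)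
      + bracket z (bracket x y) = 0
}.

#[short(type="lieAlgType")]
HB.structure Definition LieAlgebra (k : fieldType) :=
  { V of Lmodule_isLie k V & GRing.Lmodule k V }.

Notation "'[lie' x , y ]" := (bracket x y)
  (at level 0, x, y at level 99) : ring_scope.

Section LieTheory.
Variables (k : fieldType) (L : lieAlgType k).
Implicit Types x y z : L.

Lemma bracketDl x y z : [lie x + y, z] = [lie x, z] + [lie y, z].
Proof. by rewrite -[x]scale1r bracket_linearl !scale1r. Qed.
Lemma bracketDr z x y : [lie z, x + y] = [lie z, x] + [lie z, y].
Proof. by rewrite -[x]scale1r bracket_linearr !scale1r. Qed.
Lemma bracket0l z : [lie 0, z] = 0 :> L.
Proof. by apply: (addrI [lie 0, z]); rewrite -bracketDl !addr0. Qed.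
Lemma bracket0r z : [lie z, 0] = 0 :> L.
Proof. by apply: (addrI [lie z, 0]); rewrite -bracketDr !addr0. Qed.
Lemma bracketZl a x z : [lie a *: x, z] = a *: [lie x, z].
Proof. by rewrite -[a *: x]addr0 bracket_linearl bracket0l addr0. Qed.
Lemma bracketZr a z x : [lie z, a *: x] = a *: [lie z, x].
Proof. by rewrite -[a *: x]addr0 bracket_linearr bracket0r addr0. Qed.
Lemma bracketC x y : [lie x, y] = - [lie y, x].
Proof.
apply/eqP; rewrite -addr_eq0; apply/eqP.
have := bracketxx (x + y).
by rewrite bracketDl !bracketDr !bracketxx add0r addr0.
Qed.
Lemma bracketNl x y : [lie - x, y] = - [lie x, y].
Proof. by rewrite -scaleN1r bracketZl scaleN1r. Qed.
Lemma bracketNr x y : [lie x, - y] = - [lie x, y].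
Proof. by rewrite -scaleN1r bracketZr scaleN1r. Qed.
Lemma bracketBl x y z : [lie x - y, z] = [lie x, z] - [lie y, z].
Proof. by rewrite bracketDl bracketNl. Qed.
Lemma bracketBr z x y : [lie z, x - y] = [lie z, x] - [lie z, y].
Proof. by rewrite bracketDr bracketNr. Qed.
Lemma bracket_der x y z : [lie x, [lie y, z]] = [lie [lie x, y], z] + [lie y, [lie x, z]].
Proof.
have /eqP := jacobi x y z; rewrite -addrA addr_eq0 => /eqP ->.
by rewrite opprD addrC -(bracketC [lie x, y] z) -bracketNr -(bracketC x z).
Qed.

End LieTheory.

Record lieHom (k : fieldType) (L L' : lieAlgType k) := LieHom {
  lie_fun :> L -> L';
  lie_fun_linear : linear lie_fun;
  lie_fun_bracket : {morph lie_fun : x y / [lie x, y]}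
}.
HB.instance Definition _ (k : fieldType) (L L' : lieAlgType k) (f : lieHom L L') :=
  GRing.isLinear.Build k L L' _ (lie_fun f) (lie_fun_linear f).

Definition lie_isomorphic (k : fieldType) (L L' : lieAlgType k) : Prop :=
  exists f : lieHom L L', bijective f.

Definition graded_lie_isomorphic (k : fieldType) (L L' : lieAlgType k)
    (gr : nat -> set L) (gr' : nat -> set L') : Prop :=
  exists f : lieHom L L', bijective f /\ forall n, f @` gr n = gr' n.

Record lie_ideal (k : fieldType) (L : lieAlgType k) := LieIdeal {
  ideal_sub :> submodule L;
  ideal_bracket : forall x y, ideal_sub y -> ideal_sub [lie x, y]
}.

Section CommutatorIdeal.
Variables (k : fieldType) (L : lieAlgType k).

Definition full_submodule := @Submodule k L (fun=> True) I (fun _ _ _ _ _ => I).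
Definition full_ideal := @LieIdeal k L full_submodule (fun _ _ _ => I).

Definition brackets (A B : set L) : set L :=
  [set z | exists x y, [/\ A x, B y & z = [lie x, y]]].

Fact comm_ideal_subproof (A B : lie_ideal L) x y :
  lin_span (brackets A B) y -> lin_span (brackets A B) [lie x, y].
Proof.
elim=> [|a _ v [p [q [Ap Bq ->]]] _ IH]; first by rewrite bracket0r; apply: sub0.
rewrite bracket_linearr; apply: sub_lin => //; rewrite bracket_der.
by apply: subD; apply: mem_lin_span;
   [exists [lie x, p], q | exists p, [lie x, q]]; split=> //; apply: ideal_bracket.
Qed.
Definition comm_ideal (A B : lie_ideal L) := LieIdeal (@comm_ideal_subproof A B).

Definition derived (A : lie_ideal L) := comm_ideal A A.

End CommutatorIdeal.
Arguments full_ideal {k} L.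

Section LieQuotient.
Variables (k : fieldType) (L : lieAlgType k) (I : lie_ideal L).

Definition lie_quot := quot_space I.
HB.instance Definition _ := GRing.Lmodule.on lie_quot.

Definition qbracket (p q : lie_quot) : lie_quot := qpi I [lie repr p, repr q].

Fact qbracket_pi x y : qbracket (qpi I x) (qpi I y) = qpi I [lie x, y].
Proof.
have E z : I (repr (qpi I z) - z) by apply/qpi_eq; rewrite /qpi reprK.
apply/qpi_eq; rewrite -[X in I (X - _)](subrK [lie x, repr (qpi I y)]) -addrA.
rewrite -bracketBl -bracketBr; apply: subD; last exact: ideal_bracket.
by rewrite bracketC; apply: subN; apply: ideal_bracket.
Qed.

Fact qbracket_linearl a (x y z : lie_quot) :
  qbracket (a *: x + y) z = a *: qbracket x z + qbracket y z.
Proof.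
case: (qpi_surj x) => x' ->; case: (qpi_surj y) => y' ->.
case: (qpi_surj z) => z' ->.
by rewrite -linearP !qbracket_pi -linearP bracket_linearl.
Qed.
Fact qbracket_linearr a (x y z : lie_quot) :
  qbracket z (a *: x + y) = a *: qbracket z x + qbracket z y.
Proof.
case: (qpi_surj x) => x' ->; case: (qpi_surj y) => y' ->.
case: (qpi_surj z) => z' ->.
by rewrite -linearP !qbracket_pi -linearP bracket_linearr.
Qed.
Fact qbracketxx (x : lie_quot) : qbracket x x = 0.
Proof.
by case: (qpi_surj x) => x' ->; rewrite qbracket_pi bracketxx linear0.
Qed.
Fact qjacobi (x y z : lie_quot) :
  qbracket x (qbracket y z) + qbracket y (qbracket z x)
    + qbracket z (qbracket x y) = 0.
Proof.
case: (qpi_surj x) => x' ->; case: (qpi_surj y) => y' ->.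
case: (qpi_surj z) => z' ->.
by rewrite !qbracket_pi -!linearD jacobi linear0.
Qed.
HB.instance Definition _ := Lmodule_isLie.Build k lie_quot
  qbracket_linearl qbracket_linearr qbracketxx qjacobi.

Definition lie_pi_fun (x : L) : lie_quot := qpi I x.
Fact lie_pi_linear : linear lie_pi_fun.
Proof. exact: qpi_is_linear. Qed.
Fact lie_pi_bracket : {morph lie_pi_fun : x y / [lie x, y]}.
Proof. by move=> x y; rewrite /lie_pi_fun -qbracket_pi. Qed.
Definition lie_pi : lieHom L lie_quot := LieHom lie_pi_linear lie_pi_bracket.

Lemma lie_pi_surj (q : lie_quot) : exists x, q = lie_pi x.
Proof. exact: qpi_surj. Qed.

Lemma lie_pi_eq0 x : lie_pi x = 0 <-> I x.
Proof. by rewrite -(linear0 lie_pi) (qpi_eq I) subr0. Qed.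

Definition quot_deg (gr : nat -> set L) (n : nat) : set lie_quot :=
  lie_pi @` gr n.

Section Lift.
Variables (L' : lieAlgType k) (f : lieHom L L').
Hypothesis fI : forall x, I x -> f x = 0.

Definition quot_lift_fun (q : lie_quot) : L' := f (repr q).

Lemma quot_lift_pi x : quot_lift_fun (lie_pi x) = f x.
Proof.
apply/eqP; rewrite -subr_eq0 -linearB; apply/eqP/fI.
by apply/qpi_eq; rewrite /qpi reprK.
Qed.
Fact quot_lift_linear : linear quot_lift_fun.
Proof.
move=> a x y; case: (lie_pi_surj x) => x' ->; case: (lie_pi_surj y) => y' ->.
by rewrite -linearP !quot_lift_pi linearP.
Qed.
Fact quot_lift_bracket : {morph quot_lift_fun : x y / [lie x, y]}.
Proof.
move=> x y; case: (lie_pi_surj x) => x' ->; case: (lie_pi_surj y) => y' ->.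
by rewrite -lie_fun_bracket !quot_lift_pi lie_fun_bracket.
Qed.
Definition quot_lift : lieHom lie_quot L' :=
  LieHom quot_lift_linear quot_lift_bracket.

End Lift.
End LieQuotient.
Arguments lie_pi {k L} I.

Lemma comm_ideal_hom (k : fieldType) (L L' : lieAlgType k) (f : lieHom L L')
    (A B : lie_ideal L) (A' B' : lie_ideal L') :
  (forall x, A x -> A' (f x)) -> (forall x, B x -> B' (f x)) ->
  forall x, comm_ideal A B x -> comm_ideal A' B' (f x).
Proof.
move=> fA fB x; elim=> [|a _ v [p [q [Ap Bq ->]]] _ IH].
  by rewrite linear0; apply: sub0.
rewrite linearP; apply: sub_lin => //; apply: mem_lin_span.
by exists (f p), (f q); split; [apply: fA | apply: fB | rewrite /= lie_fun_bracket].
Qed.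

(* Lie(U): formal nonassociative expressions in the elements of U, modulo the
   congruence generated by the axioms of a Lie algebra and the linearity of
   U -> Lie(U) *)

Inductive lie_term (k : fieldType) (U : lmodType k) : Type :=
| TGen of U
| TZero
| TAdd of lie_term U & lie_term U
| TScale of k & lie_term U
| TBr of lie_term U & lie_term U.
Arguments TZero {k U}.

Inductive lie_eq (k : fieldType) (U : lmodType k) :
    lie_term U -> lie_term U -> Prop :=
| LE_refl s : lie_eq s s
| LE_sym s t : lie_eq s t -> lie_eq t s
| LE_trans t s u : lie_eq s t -> lie_eq t u -> lie_eq s u
| LE_add s s' t t' : lie_eq s s' -> lie_eq t t' -> lie_eq (TAdd s t) (TAdd s' t')
| LE_scale a s s' : lie_eq s s' -> lie_eq (TScale a s) (TScale a s')
| LE_br s s' t t' : lie_eq s s' -> lie_eq t t' -> lie_eq (TBr s t) (TBr s' t')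
| LE_addA s t u : lie_eq (TAdd s (TAdd t u)) (TAdd (TAdd s t) u)
| LE_addC s t : lie_eq (TAdd s t) (TAdd t s)
| LE_add0 s : lie_eq (TAdd TZero s) s
| LE_addN s : lie_eq (TAdd (TScale (-1) s) s) TZero
| LE_scaleA a b s : lie_eq (TScale a (TScale b s)) (TScale (a * b) s)
| LE_scale1 s : lie_eq (TScale 1 s) s
| LE_scaleDr a s t : lie_eq (TScale a (TAdd s t)) (TAdd (TScale a s) (TScale a t))
| LE_scaleDl a b s : lie_eq (TScale (a + b) s) (TAdd (TScale a s) (TScale b s))
| LE_brl a s t u :
    lie_eq (TBr (TAdd (TScale a s) t) u) (TAdd (TScale a (TBr s u)) (TBr t u))
| LE_brr a s t u :
    lie_eq (TBr u (TAdd (TScale a s) t)) (TAdd (TScale a (TBr u s)) (TBr u t))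
| LE_brxx s : lie_eq (TBr s s) TZero
| LE_jacobi s t u :
    lie_eq (TAdd (TAdd (TBr s (TBr t u)) (TBr t (TBr u s))) (TBr u (TBr s t))) TZero
| LE_gen a u v : lie_eq (TGen (a *: u + v)) (TAdd (TScale a (TGen u)) (TGen v)).

Section FreeLie.
Variables (k : fieldType) (U : lmodType k).
Local Notation T := (lie_term U).

HB.instance Definition _ := gen_eqMixin T.
HB.instance Definition _ := gen_choiceMixin T.

Definition lie_eqb : rel T := fun s t => `[< lie_eq s t >].

Fact lie_eqb_equiv : equiv_class_of lie_eqb.
Proof.
split=> [s|s t|t s u]; first exact/asboolP/LE_refl.
  by apply/asboolP/asboolP => H; apply: LE_sym.
by move=> /asboolP H1 /asboolP H2; apply/asboolP/(LE_trans H1 H2).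
Qed.
Canonical lie_eqb_rel := EquivRelPack lie_eqb_equiv.
Canonical lie_eqb_enc := defaultEncModRel lie_eqb.

Definition free_lie := {eq_quot lie_eqb}%qT.
HB.instance Definition _ := Choice.on free_lie.
HB.instance Definition _ := EqQuotient.on free_lie.

Definition fpi (t : T) : free_lie := (\pi_free_lie t)%qT.

Lemma fpi_eq s t : fpi s = fpi t <-> lie_eq s t.
Proof.
split=> [/eqquotP/asboolP // | H].
by apply/eqquotP/asboolP.
Qed.

Lemma fpi_surj (x : free_lie) : exists t, x = fpi t.
Proof. by exists (repr x); rewrite /fpi reprK. Qed.

Lemma repr_fpi t : lie_eq (repr (fpi t)) t.
Proof. by apply/fpi_eq; rewrite /fpi reprK. Qed.

Definition fzero : free_lie := fpi TZero.
Definition fadd (x y : free_lie) : free_lie := fpi (TAdd (repr x) (repr y)).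
Definition fscale a (x : free_lie) : free_lie := fpi (TScale a (repr x)).
Definition fopp (x : free_lie) : free_lie := fscale (-1) x.
Definition fbr (x y : free_lie) : free_lie := fpi (TBr (repr x) (repr y)).

Fact fadd_pi s t : fadd (fpi s) (fpi t) = fpi (TAdd s t).
Proof. by apply/fpi_eq/LE_add; apply: repr_fpi. Qed.
Fact fscale_pi a s : fscale a (fpi s) = fpi (TScale a s).
Proof. by apply/fpi_eq/LE_scale; apply: repr_fpi. Qed.
Fact fbr_pi s t : fbr (fpi s) (fpi t) = fpi (TBr s t).
Proof. by apply/fpi_eq/LE_br; apply: repr_fpi. Qed.

Fact faddA : associative fadd.
Proof.
move=> x y z; case: (fpi_surj x) => s ->; case: (fpi_surj y) => t ->.
by case: (fpi_surj z) => u ->; rewrite !fadd_pi; apply/fpi_eq/LE_addA.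
Qed.
Fact faddC : commutative fadd.
Proof.
move=> x y; case: (fpi_surj x) => s ->; case: (fpi_surj y) => t ->.
by rewrite !fadd_pi; apply/fpi_eq/LE_addC.
Qed.
Fact fadd0 : left_id fzero fadd.
Proof.
by move=> x; case: (fpi_surj x) => s ->; rewrite fadd_pi; apply/fpi_eq/LE_add0.
Qed.
Fact faddN : left_inverse fzero fopp fadd.
Proof.
move=> x; case: (fpi_surj x) => s ->; rewrite /fopp fscale_pi fadd_pi.
exact/fpi_eq/LE_addN.
Qed.
HB.instance Definition _ := GRing.isZmodule.Build free_lie faddA faddC fadd0 faddN.

Fact fscaleA a b v : fscale a (fscale b v) = fscale (a * b) v.
Proof.
by case: (fpi_surj v) => s ->; rewrite !fscale_pi; apply/fpi_eq/LE_scaleA.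
Qed.
Fact fscale1 : left_id 1 fscale.
Proof.
by move=> x; case: (fpi_surj x) => s ->; rewrite fscale_pi; apply/fpi_eq/LE_scale1.
Qed.
Fact fscaleDr : right_distributive fscale +%R.
Proof.
move=> a x y; case: (fpi_surj x) => s ->; case: (fpi_surj y) => t ->.
rewrite -[fpi s + fpi t]/(fadd (fpi s) (fpi t)) fadd_pi !fscale_pi.
rewrite -[RHS]/(fadd _ _) fadd_pi; exact/fpi_eq/LE_scaleDr.
Qed.
Fact fscaleDl v : {morph fscale^~ v : a b / a + b}.
Proof.
move=> a b /=; case: (fpi_surj v) => s ->; rewrite !fscale_pi.
by rewrite -[RHS]/(fadd _ _) fadd_pi; apply/fpi_eq/LE_scaleDl.
Qed.
HB.instance Definition _ :=
  GRing.Zmodule_isLmodule.Build k free_lie fscaleA fscale1 fscaleDr fscaleDl.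

Lemma fpi_add s t : fpi (TAdd s t) = fpi s + fpi t.
Proof. by rewrite -fadd_pi. Qed.
Lemma fpi_scale a s : fpi (TScale a s) = a *: fpi s.
Proof. by rewrite -fscale_pi. Qed.

Fact fbr_linearl a x y z : fbr (a *: x + y) z = a *: fbr x z + fbr y z.
Proof.
case: (fpi_surj x) => s ->; case: (fpi_surj y) => t ->; case: (fpi_surj z) => u ->.
rewrite -fpi_scale -fpi_add !fbr_pi -fpi_scale -fpi_add.
exact/fpi_eq/LE_brl.
Qed.
Fact fbr_linearr a x y z : fbr z (a *: x + y) = a *: fbr z x + fbr z y.
Proof.
case: (fpi_surj x) => s ->; case: (fpi_surj y) => t ->; case: (fpi_surj z) => u ->.
rewrite -fpi_scale -fpi_add !fbr_pi -fpi_scale -fpi_add.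
exact/fpi_eq/LE_brr.
Qed.
Fact fbrxx x : fbr x x = 0.
Proof. by case: (fpi_surj x) => s ->; rewrite fbr_pi; apply/fpi_eq/LE_brxx. Qed.
Fact fjacobi x y z :
  fbr x (fbr y z) + fbr y (fbr z x) + fbr z (fbr x y) = 0.
Proof.
case: (fpi_surj x) => s ->; case: (fpi_surj y) => t ->; case: (fpi_surj z) => u ->.
by rewrite !fbr_pi -!fpi_add; apply/fpi_eq/LE_jacobi.
Qed.
HB.instance Definition _ := Lmodule_isLie.Build k free_lie
  fbr_linearl fbr_linearr fbrxx fjacobi.

Lemma fpi_br s t : fpi (TBr s t) = [lie fpi s, fpi t].
Proof. by rewrite -fbr_pi. Qed.

Definition free_gen (u : U) : free_lie := fpi (TGen u).

Fact free_gen_linear : linear free_gen.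
Proof. by move=> a u v; rewrite -fpi_scale -fpi_add; apply/fpi_eq/LE_gen. Qed.
HB.instance Definition _ :=
  GRing.isLinear.Build k U free_lie _ free_gen free_gen_linear.

Lemma free_lie_ind (S : submodule free_lie) :
  (forall u, S (free_gen u)) ->
  (forall x y, S x -> S y -> S [lie x, y]) -> forall x, S x.
Proof.
move=> Sg Sb x; case: (fpi_surj x) => t ->{x}; elim: t => [u||s Ss t St|a s Ss|s Ss t St].
- exact: Sg.
- exact: sub0.
- by rewrite fpi_add; apply: subD.
- by rewrite fpi_scale; apply: subZ.
- by rewrite fpi_br; apply: Sb.
Qed.

Inductive free_deg : nat -> set free_lie :=
| deg_gen u : free_deg 1 (free_gen u)
| deg_bracket m n x y :
    free_deg m x -> free_deg n y -> free_deg (m + n)%N [lie x, y]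
| deg_zero n : free_deg n 0
| deg_lin n a x y : free_deg n x -> free_deg n y -> free_deg n (a *: x + y).

Section Lift.
Variables (L : lieAlgType k) (f : {linear U -> L}).

Fixpoint term_eval (t : T) : L :=
  match t with
  | TGen u => f u
  | TZero => 0
  | TAdd s t => term_eval s + term_eval t
  | TScale a s => a *: term_eval s
  | TBr s t => [lie term_eval s, term_eval t]
  end.

Lemma term_evalP s t : lie_eq s t -> term_eval s = term_eval t.
Proof.
elim=> //=.
- by move=> s1 s2 s3 _ -> _ ->.
- by move=> s1 s2 s3 s4 _ -> _ ->.
- by move=> a s1 s2 _ ->.
- by move=> s1 s2 s3 s4 _ -> _ ->.
- by move=> *; rewrite addrA.
- by move=> *; rewrite addrC.
- by move=> *; rewrite add0r.
- by move=> *; rewrite scaleN1r addNr.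
- by move=> *; rewrite scalerA.
- by move=> *; rewrite scale1r.
- by move=> *; rewrite scalerDr.
- by move=> *; rewrite scalerDl.
- by move=> *; rewrite bracket_linearl.
- by move=> *; rewrite bracket_linearr.
- by move=> *; rewrite bracketxx.
- by move=> *; rewrite jacobi.
- by move=> *; rewrite linearP.
Qed.

Definition free_lift_fun (x : free_lie) : L := term_eval (repr x).

Lemma free_lift_pi t : free_lift_fun (fpi t) = term_eval t.
Proof. exact/term_evalP/repr_fpi. Qed.

Fact free_lift_linear : linear free_lift_fun.
Proof.
move=> a x y; case: (fpi_surj x) => s ->; case: (fpi_surj y) => t ->.
by rewrite -fpi_scale -fpi_add !free_lift_pi.
Qed.
Fact free_lift_bracket : {morph free_lift_fun : x y / [lie x, y]}.
Proof.
move=> x y; case: (fpi_surj x) => s ->; case: (fpi_surj y) => t ->.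
by rewrite -fpi_br !free_lift_pi.
Qed.
Definition free_lift : lieHom free_lie L := LieHom free_lift_linear free_lift_bracket.

Lemma free_lift_gen u : free_lift (free_gen u) = f u.
Proof. exact: free_lift_pi. Qed.

Lemma free_lift_unique (g : lieHom free_lie L) :
  (forall u, g (free_gen u) = f u) -> g =1 free_lift.
Proof.
move=> gf x; case: (fpi_surj x) => t ->{x}; elim: t => [u||s Ss t St|a s Ss|s Ss t St].
- by rewrite gf free_lift_gen.
- by rewrite !linear0.
- by rewrite fpi_add !linearD /= Ss St.
- by rewrite fpi_scale !linearZ /= Ss.
- by rewrite fpi_br !lie_fun_bracket Ss St.
Qed.

End Lift.
End FreeLie.
Arguments free_gen {k U} u.

Section FreeMetabelian.
Variables (k : fieldType) (U : lmodType k).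

Definition free_lie'' : lie_ideal (free_lie U) :=
  derived (derived (full_ideal (free_lie U))).

Definition Mlie : lieAlgType k := lie_quot free_lie''.

Definition M_gen (u : U) : Mlie := lie_pi free_lie'' (free_gen u).

Fact M_gen_linear : linear M_gen.
Proof. by move=> a u v; rewrite /M_gen !linearP. Qed.
HB.instance Definition _ := GRing.isLinear.Build k U Mlie _ M_gen M_gen_linear.

Definition M_deg : nat -> set Mlie := quot_deg (@free_deg k U).

Definition Mlie' : lie_ideal Mlie := derived (full_ideal Mlie).

Definition Bmod : lmodType k := subspace Mlie'.

(* internal degree r is Lie degree r + 2 *)
Definition B_deg (r : nat) : set Bmod := [set b | M_deg r.+2 (sub_val b)].

Lemma M'_bracket x y : Mlie' [lie x, y].
Proof. by apply: mem_lin_span; exists x, y. Qed.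

Lemma M'_lift x : Mlie' x ->
  exists2 y, derived (full_ideal (free_lie U)) y & x = lie_pi free_lie'' y.
Proof.
elim=> [|a _ v [p [q [_ _ ->]]] _ [y Dy ->]].
  by exists 0; [apply: sub0 | rewrite linear0].
case: (lie_pi_surj p) => p' ->; case: (lie_pi_surj q) => q' ->.
exists (a *: [lie p', q'] + y); last by rewrite -lie_fun_bracket -linearP.
by apply: sub_lin => //; apply: mem_lin_span; exists p', q'.
Qed.

Lemma M_metabelian x y : Mlie' x -> Mlie' y -> [lie x, y] = 0.
Proof.
move=> /M'_lift[x' Dx ->] /M'_lift[y' Dy ->].
by rewrite -lie_fun_bracket; apply/lie_pi_eq0/mem_lin_span; exists x', y'.
Qed.

Lemma M_decomp x : exists u, Mlie' (x - M_gen u).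
Proof.
pose P := [set y | exists u, Mlie' (lie_pi free_lie'' y - M_gen u)].
have P0 : P 0 by exists 0; rewrite !linear0 addr0; apply: sub0.
have PL a y z : P y -> P z -> P (a *: y + z).
  move=> [u Hu] [v Hv]; exists (a *: u + v).
  rewrite (linearP M_gen) (linearP (lie_pi _)) opprD addrACA.
  by rewrite -scalerBr; apply: sub_lin.
case: (lie_pi_surj x) => y ->{x}.
apply: (free_lie_ind (S := Submodule P0 PL)) => [u|y1 y2 _ _].
  by exists u; rewrite subrr; apply: sub0.
by exists 0; rewrite linear0 subr0 lie_fun_bracket; apply: M'_bracket.
Qed.

Lemma M_gen_deg u b n : M_deg n b -> M_deg n.+1 [lie M_gen u, b].
Proof.
case=> y Dy <-; exists [lie free_gen u, y]; last by rewrite lie_fun_bracket.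
by rewrite -add1n; apply: deg_bracket => //; apply: deg_gen.
Qed.

Lemma M_deg_closed n a x y : M_deg n x -> M_deg n y -> M_deg n (a *: x + y).
Proof.
move=> [x' Dx <-] [y' Dy <-]; exists (a *: x' + y'); last by rewrite linearP.
exact: deg_lin.
Qed.

Definition B_ad_fun (x : Mlie) (b : Bmod) : Bmod := to_sub (M'_bracket x (sub_val b)).
Fact B_ad_linear x : linear (B_ad_fun x).
Proof. by move=> a b c; apply: val_inj; rewrite /= bracket_linearr. Qed.
HB.instance Definition _ x :=
  GRing.isLinear.Build k Bmod Bmod _ (B_ad_fun x) (B_ad_linear x).
Definition B_ad (u : U) : {linear Bmod -> Bmod} := B_ad_fun (M_gen u).

Lemma B_adC u v b : B_ad u (B_ad v b) = B_ad v (B_ad u b).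
Proof.
apply: val_inj => /=; rewrite bracket_der M_metabelian ?add0r //.
  exact: M'_bracket.
exact: sub_valP.
Qed.

End FreeMetabelian.
Arguments M_gen {k U} u.

Section Functor.
Variables (k : fieldType) (U U' : lmodType k) (P : {linear U -> U'}).

Fact free_gen_comp_linear : linear (fun u => free_gen (P u)).
Proof. by move=> a u v; rewrite !linearP. Qed.
Definition free_gen_comp : {linear U -> free_lie U'} :=
  HB.pack (fun u => free_gen (P u)) (GRing.isLinear.Build _ _ _ _ _ free_gen_comp_linear).

Definition free_map : lieHom (free_lie U) (free_lie U') := free_lift free_gen_comp.

Fact M_pre_linear : linear (fun x => lie_pi (free_lie'' U') (free_map x)).
Proof. by move=> a x y; rewrite !linearP. Qed.
Fact M_pre_bracket :
  {morph (fun x => lie_pi (free_lie'' U') (free_map x)) : x y / [lie x, y]}.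
Proof. by move=> x y; rewrite !lie_fun_bracket. Qed.
Definition M_pre : lieHom (free_lie U) (Mlie U') := LieHom M_pre_linear M_pre_bracket.

Fact M_pre_kills x : free_lie'' U x -> M_pre x = 0.
Proof.
move=> Dx; apply/lie_pi_eq0; move: x Dx.
by do 2![apply: comm_ideal_hom => //].
Qed.
Definition M_map : lieHom (Mlie U) (Mlie U') := quot_lift M_pre_kills.

Lemma M_map_pi x : M_map (lie_pi _ x) = lie_pi _ (free_map x).
Proof. exact: (quot_lift_pi M_pre_kills x). Qed.

Lemma M_map_gen u : M_map (M_gen u) = M_gen (P u).
Proof. by rewrite /M_gen M_map_pi free_lift_gen. Qed.

Lemma free_map_deg n x : free_deg n x -> free_deg n (free_map x).
Proof.
elim=> {n x} [u|m n x y _ Hx _ Hy|n|n a x y _ Hx _ Hy].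
- by rewrite free_lift_gen; apply: deg_gen.
- by rewrite lie_fun_bracket; apply: deg_bracket.
- by rewrite linear0; apply: deg_zero.
- by rewrite linearP; apply: deg_lin.
Qed.

Lemma M_map_deg n x : M_deg n x -> M_deg n (M_map x).
Proof.
case=> y Dy <-; rewrite M_map_pi; exists (free_map y) => //.
exact: free_map_deg.
Qed.

Lemma M_map_M' x : Mlie' U x -> Mlie' U' (M_map x).
Proof. exact: comm_ideal_hom. Qed.

Definition B_map_fun (b : Bmod U) : Bmod U' := to_sub (M_map_M' (sub_valP b)).
Fact B_map_linear : linear B_map_fun.
Proof. by move=> a b c; apply: val_inj; exact: (lie_fun_linear M_map). Qed.
HB.instance Definition _ :=
  GRing.isLinear.Build k (Bmod U) (Bmod U') _ B_map_fun B_map_linear.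
Definition B_map : {linear Bmod U -> Bmod U'} := B_map_fun.

End Functor.

Section PolyAction.
Variables (k : fieldType) (V : lmodType k) (d : nat) (t : 'I_d -> {linear V -> V}).

Definition mon_act (m : 'X_{1..d}) (v : V) : V :=
  foldr (fun i w => iter (m i) (t i) w) v (enum 'I_d).

Definition poly_act (p : {mpoly k[d]}) (v : V) : V :=
  \sum_(m <- msupp p) p@_m *: mon_act m v.

Lemma mon_act_closed (S : nat -> submodule V) :
  (forall i r v, S r v -> S r.+1 (t i v)) ->
  forall m r v, S r v -> exists2 r', (r <= r')%N & S r' (mon_act m v).
Proof.
move=> St m r v Sv; rewrite /mon_act; elim: (enum _) => [|i e [r' le Sr']] /=.
  by exists r.
elim: (m i) => [|n [r2 le2 S2]] /=; first by exists r'.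
by exists r2.+1; [apply: leqW | apply: St].
Qed.

Fact mon_act_linear m : linear (mon_act m).
Proof.
move=> a v w; rewrite /mon_act; elim: (enum _) => //= i e ->.
by elim: (m i) => //= n ->; rewrite linearP.
Qed.
HB.instance Definition _ m :=
  GRing.isLinear.Build k V V _ (mon_act m) (mon_act_linear m).

Fact poly_act_linear p : linear (poly_act p).
Proof.
move=> a v w; rewrite /poly_act scaler_sumr -big_split /=.
by apply: eq_bigr => m _; rewrite linearP scalerDr !scalerA mulrC.
Qed.
HB.instance Definition _ p :=
  GRing.isLinear.Build k V V _ (poly_act p) (poly_act_linear p).

Lemma poly_actE p n v : (msize p <= n)%N ->
  poly_act p v = \sum_(m : 'X_{1..d < n}) p@_m *: mon_act m v.
Proof.
move=> le_pn; pose I : subFinType _ := 'X_{1..d < n}.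
rewrite /poly_act (big_mksub I) ?msupp_uniq //=; last first.
  by move=> x /msize_mdeg_lt /leq_trans; apply.
by rewrite big_rmcond //= => m /memN_msupp_eq0 ->; rewrite scale0r.
Qed.

Lemma poly_actP a p q v : poly_act (a *: p + q) v = a *: poly_act p v + poly_act q v.
Proof.
pose n := maxn (msize (a *: p + q)) (maxn (msize p) (msize q)).
rewrite !(@poly_actE _ n) ?leq_max ?leqnn ?orbT // scaler_sumr -big_split /=.
by apply: eq_bigr => m _; rewrite mcoeffD mcoeffZ scalerDl scalerA.
Qed.

Lemma poly_actX m v : poly_act 'X_[m] v = mon_act m v.
Proof. by rewrite /poly_act msuppX big_seq1 mcoeffX eqxx scale1r. Qed.

Lemma poly_act0 v : poly_act 0 v = 0.
Proof. by rewrite /poly_act msupp0 big_nil. Qed.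

Lemma poly_act1 v : poly_act 1 v = v.
Proof.
rewrite -mpolyX0 poly_actX /mon_act; elim: (enum _) => //= i e ->.
by rewrite mnm0E.
Qed.

Lemma poly_actXi i v : poly_act 'X_i v = t i v.
Proof.
rewrite poly_actX /mon_act.
have := enum_uniq 'I_d; have := mem_enum 'I_d i.
elim: (enum _) => [//|j e IH]; rewrite inE /= => Hj /andP[nj ue].
rewrite mnm1E; case: eqVneq Hj => [-> _|ne]; last first.
  by rewrite /= => /IH ->.
rewrite /=; congr (t j _).
elim: e nj {IH ue} => //= l e IH; rewrite inE negb_or => /andP[nl /IH ->].
by rewrite mnm1E (negbTE nl).
Qed.

Hypothesis tC : forall i j v, t i (t j v) = t j (t i v).

Lemma mon_actD m1 m2 v : mon_act (m1 + m2)%MM v = mon_act m1 (mon_act m2 v).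
Proof.
have itC n1 n2 i j w : iter n1 (t i) (iter n2 (t j) w) = iter n2 (t j) (iter n1 (t i) w).
  elim: n1 => //= n1 ->; elim: n2 => //= n2 <-; exact: tC.
rewrite /mon_act; elim: (enum _) => //= i e ->.
rewrite mnmDE iterD; congr iter; move: (foldr _ v e) => w.
by elim: e => //= j e IH; rewrite itC IH.
Qed.

Lemma poly_actM p q v : poly_act (p * q) v = poly_act p (poly_act q v).
Proof.
elim/mpolyind: p => [|c m p _ _ IH]; first by rewrite mul0r !poly_act0.
rewrite mulrDl -scalerAl !poly_actP IH; congr (_ *: _ + _); rewrite poly_actX.
elim/mpolyind: q {IH} => [|c' m' q _ _ IH].
  by rewrite mulr0 !poly_act0 linear0.
by rewrite mulrDr -scalerAr !poly_actP linearP IH -mpolyXD !poly_actX mon_actD.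
Qed.

End PolyAction.

Section SymAction.
Variables (k : fieldType) (U : vectType k).

(* Sym(U) is the polynomial ring on a basis of U; Sym_gen embeds U in it *)
Definition Sym := {mpoly k[\dim {:U}]}.

Definition Sym_gen (u : U) : Sym := \sum_i coord (vbasis {:U}) i u *: 'X_i.

Definition B_act : Sym -> Bmod U -> Bmod U :=
  poly_act (fun i => B_ad (vbasis {:U})`_i).

(* By B_act1, B_actM, B_actPl, B_actPr and B_act_gen, B_act is the R-module
   structure with u . b = [u, b]; it does not depend on the chosen basis. *)
Lemma B_act1 b : B_act 1 b = b.
Proof. exact: poly_act1. Qed.

Lemma B_actM p q b : B_act (p * q) b = B_act p (B_act q b).
Proof. by apply: poly_actM => i j v; apply: B_adC. Qed.

Lemma B_actPl a p q b : B_act (a *: p + q) b = a *: B_act p b + B_act q b.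
Proof. exact: poly_actP. Qed.

Lemma B_actPr p a b c : B_act p (a *: b + c) = a *: B_act p b + B_act p c.
Proof. exact: poly_act_linear. Qed.

Lemma B_act_gen u b : sub_val (B_act (Sym_gen u) b) = [lie M_gen u, sub_val b].
Proof.
have -> : B_act (Sym_gen u) b =
    \sum_i coord (vbasis {:U}) i u *: B_ad (vbasis {:U})`_i b.
  rewrite /Sym_gen; elim/big_rec2: _ => [|i x y _ <-]; first exact: poly_act0.
  by rewrite B_actPl /B_act poly_actXi.
rewrite [in RHS](coord_vbasis (memvf u)) linear_sum /=.
elim/big_rec2: _ => [|i x y _ E]; first by rewrite bracket0l.
by rewrite linearZ /= bracket_linearl -E.
Qed.

End SymAction.

Section RestrictedDual.
Variables (k : fieldType) (U : vectType k).

(* The direct sum of the B(U)_r^* is realised as the space of the linear forms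
   on B(U) that vanish on B(U)_r for r large. *)
Definition restricted_form : set (Bmod U -> k^o) :=
  [set Phi | linear Phi /\
     exists N, forall r b, (N <= r)%N -> B_deg r b -> Phi b = 0].

Fact restricted_form0 : restricted_form 0.
Proof. by split; [move=> a b c; rewrite /= scaler0 addr0 | exists 0]. Qed.
Fact restricted_form_lin a Phi Psi :
  restricted_form Phi -> restricted_form Psi -> restricted_form (a *: Phi + Psi).
Proof.
move=> [lPhi [m Hm]] [lPsi [n Hn]]; split.
  move=> c x y; rewrite !addrfctE !scalrfctE lPhi lPsi !scalerDr addrACA !scalerA.
  by rewrite mulrC.
exists (maxn m n) => r b; rewrite geq_max => /andP[mr nr] Db.
by rewrite addrfctE scalrfctE (Hm r) ?(Hn r) // scaler0 addr0.
Qed.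
Definition Z2_sub := Submodule restricted_form0 restricted_form_lin.

Definition Z2 : lmodType k := subspace Z2_sub.

Definition pairing (b : Bmod U) (Phi : Z2) : k := sub_val Phi b.

Definition Z2_deg (r : nat) : set Z2 :=
  [set Phi | forall s b, s <> r -> B_deg s b -> pairing b Phi = 0].

Fact B_deg0 r : @B_deg k U r 0.
Proof. by exists 0; [apply: deg_zero | rewrite linear0]. Qed.
Definition B_deg_sub r : submodule (Bmod U) :=
  Submodule (B_deg0 r) (fun a x y => @M_deg_closed k U r.+2 a (sub_val x) (sub_val y)).

Fact contract_subproof (p : Sym U) (Phi : Z2) :
  Z2_sub (fun b => sub_val Phi (B_act p b)).
Proof.
have [lPhi [N HN]] := sub_valP Phi; split.
  by move=> a b c; rewrite B_actPr lPhi.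
exists N => r b le_Nr Db; rewrite /B_act /poly_act.
have ev0 : sub_val Phi 0 = 0.
  by apply: (HN r) => //; apply: (B_deg0 r).
elim/big_rec: _ => [//|m c _ Hc]; rewrite lPhi Hc addr0.
have [|r' le Dr'] := @mon_act_closed _ _ _
    (fun i => B_ad (vbasis {:U})`_i) B_deg_sub _ m r b Db.
  by move=> i s v; apply: M_gen_deg.
by rewrite (HN r') ?scaler0 // (leq_trans le_Nr).
Qed.
Definition contract (p : Sym U) (Phi : Z2) : Z2 := to_sub (contract_subproof p Phi).

Lemma pairing_contract p Phi b : pairing b (contract p Phi) = pairing (B_act p b) Phi.
Proof. by []. Qed.

Record graded_submodule := GradedSubmodule {
  gsub_sub :> submodule Z2;
  gsub_contract : forall p Phi, gsub_sub Phi -> gsub_sub (contract p Phi);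
  gsub_graded : forall Phi, gsub_sub Phi ->
    exists N (Psi : 'I_N -> Z2), (forall r, gsub_sub (Psi r) /\ Z2_deg r (Psi r))
      /\ Phi = \sum_r Psi r
}.

Variable W : graded_submodule.

Definition annihilator_set : set (Mlie U) :=
  [set x | exists2 b : Bmod U, x = sub_val b & forall Phi, W Phi -> pairing b Phi = 0].

Lemma pairing_linear (Phi : Z2) : linear (pairing^~ Phi : Bmod U -> k^o).
Proof. exact: (sub_valP Phi).1. Qed.

Fact annihilator0 : annihilator_set 0.
Proof.
exists 0 => // Phi _; have := pairing_linear Phi (-1) 0 0.
by rewrite scaler0 addr0 scaleN1r addNr.
Qed.
Fact annihilator_lin a x y :
  annihilator_set x -> annihilator_set y -> annihilator_set (a *: x + y).
Proof.
move=> [b -> Hb] [c -> Hc]; exists (a *: b + c) => // Phi WPhi.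
by rewrite pairing_linear Hb // Hc // scaler0 addr0.
Qed.
Fact annihilator_bracket x y :
  annihilator_set y -> annihilator_set [lie x, y].
Proof.
move=> [b -> Hb]; have [u Du] := M_decomp x.
exists (B_act (Sym_gen u) b).
  rewrite B_act_gen -{1}[x](subrK (M_gen u)) bracketDl M_metabelian ?add0r //.
  exact: sub_valP.
by move=> Phi WPhi; rewrite -pairing_contract; apply/Hb/gsub_contract.
Qed.
Definition annihilator : lie_ideal (Mlie U) :=
  @LieIdeal _ _ (Submodule annihilator0 annihilator_lin) annihilator_bracket.

Definition g_lie : lieAlgType k := lie_quot annihilator.

Definition g_deg : nat -> set g_lie := quot_deg (@M_deg k U).

End RestrictedDual.

Section Pullback.
Variables (k : fieldType) (U U' : vectType k) (P : {linear U -> U'}).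

Fact pullback_subproof (Phi : Z2 U') :
  Z2_sub U (fun b => pairing (B_map P b) Phi : k^o).
Proof.
have [lPhi [N HN]] := sub_valP Phi; split.
  by move=> a b c; rewrite linearP pairing_linear.
by exists N => r b le Db; apply: (HN r) => //; apply: M_map_deg.
Qed.
Definition pullback (Phi : Z2 U') : Z2 U := to_sub (pullback_subproof Phi).

End Pullback.

(* Main.v *)
(* The abelianization of [g_W] is [U], so a Lie isomorphism [f : g_W -> g_W']
   induces a linear isomorphism [P : U -> U'], and [f] agrees with the map
   [M(P)] up to terms of higher degree.  As [W^perp] and [W'^perp] are graded,
   comparing leading terms shows that [M(P)] itself maps [W^perp] into
   [W'^perp], that is, [P^* W'] annihilates [W^perp]; as [W] is finite
   dimensional it is its own biannihilator, so [P^* W'] is contained in [W].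
   The inverse of [f] induces the inverse of [P], which gives the converse
   inclusion. *)
Require Import Defs.
From HB Require Import structures.
From mathcomp Require Import all_boot all_order all_algebra.
From mathcomp Require Import mpoly boolp classical_sets functions.

Set Implicit Arguments.
Unset Strict Implicit.
Unset Printing Implicit Defensive.

Import GRing.Theory.
Local Open Scope ring_scope.
Local Open Scope classical_set_scope.

(** * Composition and inversion of Lie homomorphisms *)

Section LieHomTheory.
Variable k : fieldType.

Section Comp.
Variables (L1 L2 L3 : lieAlgType k) (g : lieHom L2 L3) (f : lieHom L1 L2).

Fact lie_comp_linear : linear (fun x => g (f x)).
Proof. by move=> a x y; rewrite !linearP. Qed.
Fact lie_comp_bracket : {morph (fun x => g (f x)) : x y / [lie x, y]}.
Proof. by move=> x y; rewrite !lie_fun_bracket. Qed.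
Definition lie_comp : lieHom L1 L3 := LieHom lie_comp_linear lie_comp_bracket.

End Comp.

Lemma lie_hom_inverse (L L' : lieAlgType k) (f : lieHom L L') :
  bijective f -> exists g : lieHom L' L, cancel f g /\ cancel g f.
Proof.
case=> g fK gK; have g_linear : linear g.
  by move=> a x y; apply: (can_inj fK); rewrite (lie_fun_linear f) !gK.
have g_bracket : {morph g : x y / [lie x, y]}.
  by move=> x y; apply: (can_inj fK); rewrite lie_fun_bracket !gK.
by exists (LieHom g_linear g_bracket).
Qed.

Lemma lie_hom_derived (L L' : lieAlgType k) (f : lieHom L L') x :
  derived (full_ideal L) x -> derived (full_ideal L') (f x).
Proof. exact: comm_ideal_hom. Qed.

End LieHomTheory.

(** An alias of [U], so that the zero bracket is attached to a type of its own rather than to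
    [U]. *)
Definition abelian_lie (k : fieldType) (U : lmodType k) : Type := U.

(** * The projection of [M(U)] onto its abelianization [U] *)

Section AbelianLie.
Variables (k : fieldType) (U : lmodType k).

HB.instance Definition _ := GRing.Lmodule.on (abelian_lie U).

Let zero_bracket (x y : abelian_lie U) : abelian_lie U := 0.

Fact zero_bracket_linearl a x y z :
  zero_bracket (a *: x + y) z = a *: zero_bracket x z + zero_bracket y z.
Proof. by rewrite /zero_bracket scaler0 addr0. Qed.
Fact zero_bracket_linearr a x y z :
  zero_bracket z (a *: x + y) = a *: zero_bracket z x + zero_bracket z y.
Proof. by rewrite /zero_bracket scaler0 addr0. Qed.
Fact zero_bracketxx x : zero_bracket x x = 0.
Proof. by []. Qed.
Fact zero_bracket_jacobi x y z :
  zero_bracket x (zero_bracket y z) + zero_bracket y (zero_bracket z x)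
    + zero_bracket z (zero_bracket x y) = 0.
Proof. by rewrite /zero_bracket !addr0. Qed.
HB.instance Definition _ := Lmodule_isLie.Build k (abelian_lie U)
  zero_bracket_linearl zero_bracket_linearr zero_bracketxx zero_bracket_jacobi.

Lemma abelian_hom_derived (L : lieAlgType k) (f : lieHom L (abelian_lie U)) x :
  derived (full_ideal L) x -> f x = 0.
Proof.
elim=> [|a _ v [p [q [_ _ ->]]] _ IH]; first by rewrite linear0.
by rewrite lie_fun_linear lie_fun_bracket IH addr0; apply: scaler0.
Qed.

Fact to_abelian_linear : linear (fun u : U => u : abelian_lie U).
Proof. by []. Qed.
Definition to_abelian : {linear U -> abelian_lie U} :=
  HB.pack (fun u : U => u : abelian_lie U)
    (GRing.isLinear.Build _ _ _ _ _ to_abelian_linear).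

Definition free_proj : lieHom (free_lie U) (abelian_lie U) := free_lift to_abelian.

Fact free_proj_kills x : free_lie'' U x -> free_proj x = 0.
Proof.
move=> Dx; apply: abelian_hom_derived; move: x Dx.
(* The second derived ideal lies in the first: its spanning elements are themselves brackets. *)
apply: lin_span_ind => _ [x [y [_ _ ->]]].
by apply: mem_lin_span; exists x, y.
Qed.

Definition M_proj : lieHom (Mlie U) (abelian_lie U) := quot_lift free_proj_kills.

Lemma M_proj_gen u : M_proj (M_gen u) = u.
Proof.
exact: etrans (quot_lift_pi free_proj_kills _) (free_lift_gen to_abelian u).
Qed.

End AbelianLie.

(** On free Lie algebras the composite and the identity are homomorphisms that agree on generators,
    hence equal; the equality descends to the quotients. *)
Lemma M_map_cancel (k : fieldType) (U U' : lmodType k) (P : {linear U -> U'})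
    (Q : {linear U' -> U}) : cancel P Q -> cancel (M_map P) (M_map Q).
Proof.
move=> PK x; case: (lie_pi_surj x) => y ->{x}; rewrite !M_map_pi; congr (lie_pi _ _).
have id_linear : linear (fun x : free_lie U => x) by [].
have id_bracket : {morph (fun x : free_lie U => x) : x y / [lie x, y]} by [].
have gen u : lie_comp (free_map Q) (free_map P) (free_gen u) = free_gen u.
  have EP : free_map P (free_gen u) = free_gen (P u) := free_lift_gen _ u.
  have EQ v : free_map Q (free_gen v) = free_gen (Q v) := free_lift_gen _ v.
  by rewrite -[LHS]/(free_map Q (free_map P (free_gen u))) EP EQ PK.
have idE := free_lift_unique (g := LieHom id_linear id_bracket) (fun=> erefl).
exact: etrans (free_lift_unique gen y) (esym (idE y)).
Qed.

(** * The degree filtration of [M(U)] and homogeneous decompositions in [B(U)] *)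

Section Filtration.
Variables (k : fieldType) (U : lmodType k).

(** The descending filtration that measures by how much a Lie homomorphism fails to be graded. *)
Definition M_fil (n : nat) : submodule (Mlie U) :=
  lin_span [set x | exists2 m, (n <= m)%N & M_deg m x].

Lemma M_fil_deg n m x : (n <= m)%N -> M_deg m x -> M_fil n x.
Proof. by move=> le_nm Dx; apply: mem_lin_span; exists m. Qed.

Lemma M_deg_bracket m n (x y : Mlie U) :
  M_deg m x -> M_deg n y -> M_deg (m + n)%N [lie x, y].
Proof.
move=> [x' Dx <-] [y' Dy <-]; exists [lie x', y']; last by rewrite lie_fun_bracket.
exact: deg_bracket.
Qed.

Lemma M_fil_bracket m n x y : M_fil m x -> M_fil n y -> M_fil (m + n) [lie x, y].
Proof.
move=> Fx Fy; elim: Fx => [|a u v [i le_mi Du] _ IH].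
  by rewrite bracket0l; apply: sub0.
rewrite bracket_linearl; apply: sub_lin => //.
elim: Fy => [|b w z [j le_nj Dw] _ IH']; first by rewrite bracket0r; apply: sub0.
rewrite bracket_linearr; apply: sub_lin => //.
by apply: (@M_fil_deg _ (i + j)); [apply: leq_add | apply: M_deg_bracket].
Qed.

Lemma M_fil1 x : M_fil 1 x.
Proof.
case: (lie_pi_surj x) => y ->{x}.
have P0 : M_fil 1 (lie_pi (free_lie'' U) 0) by rewrite linear0; apply: sub0.
have PL a v w : M_fil 1 (lie_pi (free_lie'' U) v) ->
    M_fil 1 (lie_pi (free_lie'' U) w) -> M_fil 1 (lie_pi _ (a *: v + w)).
  by move=> Fv Fw; rewrite linearP; apply: sub_lin.
apply: (free_lie_ind (S := Submodule P0 PL)) => [u|x z Hx Hz].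
  by apply: (@M_fil_deg _ 1) => //; exists (free_gen u); [apply: deg_gen|].
change (M_fil 1 (lie_pi (free_lie'' U) [lie x, z])); rewrite lie_fun_bracket.
move: (M_fil_bracket Hx Hz); apply: lin_span_ind => w [m le_m Dw].
by apply: M_fil_deg Dw; apply: ltnW.
Qed.

Lemma M'_fil x : Mlie' U x -> M_fil 2 x.
Proof.
apply: lin_span_ind => _ [y [z [_ _ ->]]].
exact: (M_fil_bracket (M_fil1 y) (M_fil1 z)).
Qed.

(** The bound on [n] excludes the generators, and every other homogeneous element is built from
    brackets. *)
Lemma free_deg_derived n (x : free_lie U) :
  free_deg n x -> (1 < n)%N -> derived (full_ideal (free_lie U)) x.
Proof.
elim=> {n x} [u //|m n x y _ _ _ _ _|n _|n a x y _ Hx _ Hy lt1n].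
- by apply: mem_lin_span; exists x, y.
- exact: sub0.
- by apply: sub_lin; [apply: Hx | apply: Hy].
Qed.

Lemma M_deg_M' n x : (1 < n)%N -> M_deg n x -> Mlie' U x.
Proof.
move=> lt1n [y Dy <-]; apply: lie_hom_derived.
exact: free_deg_derived Dy lt1n.
Qed.

Lemma B_degP n (x : Mlie U) : M_deg n.+2 x ->
  exists2 b : Bmod U, B_deg n b & x = sub_val b.
Proof. by move=> Dx; exists (to_sub (M_deg_M' (isT : 1 < n.+2)%N Dx)). Qed.

Lemma B_homogeneous_sum (b : Bmod U) :
  exists N (c : nat -> Bmod U), (forall i, B_deg i (c i)) /\ b = \sum_(i < N) c i.
Proof.
have D0 r : B_deg r (0 : Bmod U).
  by exists 0; [apply: deg_zero | rewrite linear0].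
pose P x := exists N (c : nat -> Bmod U),
  (forall i, B_deg i (c i)) /\ x = \sum_(i < N) sub_val (c i).
suff [N [c [Dc Eb]]] : P (sub_val b).
  exists N, c; split=> //; apply: val_inj; rewrite /= Eb.
  by elim/big_rec2: _ => // i y z _ ->.
(* [B(U)] lies in filtration level 2, so the induction over the span meets only Lie degrees [m.+2],
   that is, internal degrees [m]. *)
have := M'_fil (sub_valP b); move: (sub_val b) => x.
elim=> [|a u v [[|[|m]] // _ Du] _ [N [c [Dc ->]]]].
  by exists 0, (fun=> 0); split; rewrite ?big_ord0.
have [d Dd ->] := B_degP Du.
(* The values of [c] from [N] on are arbitrary; they are cut off before the range of summation grows
   to include [m]. *)
pose e i := if (i < N)%N then c i else 0.
exists (maxn N m.+1), (fun i => (if i == m then a *: d else 0) + e i); split.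
  move=> i; rewrite -[if _ then a *: d else 0](scale1r).
  apply: M_deg_closed; last first.
    by rewrite /e; case: ifP => _; [apply: Dc | apply: D0].
  case: eqP => [->|_]; last exact: D0.
  by rewrite -[a *: d]addr0; apply: M_deg_closed Dd (D0 m).
rewrite [RHS](eq_bigr (fun i : 'I__ => sub_val (if i == m :> nat then a *: d else 0)
  + sub_val (e i))) // big_split /=; congr (_ + _).
  have lt_m : (m < maxn N m.+1)%N by rewrite leq_max leqnn orbT.
  rewrite (bigD1 (Ordinal lt_m)) //= eqxx big1 ?addr0 // => i.
  by rewrite -val_eqE /= => /negbTE ->.
rewrite (big_ord_widen _ (fun i => sub_val (c i)) (leq_maxl N m.+1)) big_mkcond.
by apply: eq_bigr => i _; rewrite /e; case: ifP.
Qed.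

End Filtration.

(** * Annihilators, biannihilators and their compatibility with the grading *)

Section Duality.
Variables (k : fieldType) (U : vectType k).
Implicit Types (b c : Bmod U) (Phi Psi : Z2 U) (W : graded_submodule U).

Lemma pairing0 Phi : pairing 0 Phi = 0.
Proof.
have := pairing_linear Phi (-1) 0 0.
by rewrite scaler0 addr0 scaleN1r addNr.
Qed.

Lemma pairingD b c Phi : pairing (b + c) Phi = pairing b Phi + pairing c Phi.
Proof. by have := pairing_linear Phi 1 b c; rewrite !scale1r. Qed.

Lemma pairing_sum I (r : seq I) (F : I -> Bmod U) Phi :
  pairing (\sum_(i <- r) F i) Phi = \sum_(i <- r) pairing (F i) Phi.
Proof.
by elim/big_rec2: _ => [|i x y _ <-]; [apply: pairing0 | rewrite pairingD].
Qed.

Lemma pairing_linearr b : linear (pairing b : Z2 U -> k^o).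
Proof. by []. Qed.
HB.instance Definition _ b :=
  GRing.isLinear.Build k (Z2 U) k^o _ (pairing b) (pairing_linearr b).

Lemma pairing_ext Phi Psi : (forall b, pairing b Phi = pairing b Psi) -> Phi = Psi.
Proof. by move=> E; apply: val_inj; apply: funext => b; apply: E. Qed.

(** Induction on the list: either a multiple of the head form can be subtracted from [Psi], or the
    head form already vanishes on the common kernel of the tail. *)
Lemma common_kernel_span (s : seq (Z2 U)) Psi :
  (forall b, (forall Phi, Phi \in s -> pairing b Phi = 0) -> pairing b Psi = 0) ->
  lin_span [set` s] Psi.
Proof.
elim: s Psi => [|Phi s IH] Psi H.
  suff -> : Psi = 0 by apply: sub0.
  by apply: pairing_ext => b; rewrite H // linear0.
have sub_s : lin_span [set` s] `<=` lin_span [set` Phi :: s].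
  apply: lin_span_ind => x xs; apply: mem_lin_span => /=.
  by rewrite inE; apply/orP; right.
have [[b0 [b0s nz]]|no_b0] := pselect
    (exists b, (forall Xi, Xi \in s -> pairing b Xi = 0) /\ pairing b Phi <> 0).
  (* With this coefficient [Psi - a *: Phi] vanishes at [b0]. *)
  move/eqP: nz => nz; pose a := pairing b0 Psi / pairing b0 Phi.
  rewrite -[Psi](subrK (a *: Phi)); apply: subD; last first.
    by apply/subZ/mem_lin_span; rewrite /= mem_head.
  apply/sub_s/IH => b bs; rewrite linearB linearZ /=.
  (* This is [b] moved along [b0] into the kernel of [Phi]; it stays in the common kernel of [s]. *)
  have := H (- (pairing b Phi / pairing b0 Phi) *: b0 + b).
  rewrite pairing_linear => E; rewrite -[RHS]E => [|Xi].
    have Ea : a * pairing b Phi = pairing b Phi / pairing b0 Phi * pairing b0 Psi.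
      by rewrite /a mulrAC [RHS]mulrAC [_ * pairing b Phi]mulrC.
    by rewrite addrC scaleNr; congr (_ - _).
  rewrite pairing_linear inE => /orP[/eqP ->|Xis].
    by rewrite scaleNr [X in - X](divfK nz) addNr.
  by rewrite (b0s Xi) // (bs Xi) // scaler0 addr0.
apply/sub_s/IH => b bs; apply: H => Xi; rewrite inE => /orP[/eqP ->|]; last exact: bs.
by apply: contrapT => nz; apply: no_b0; exists b.
Qed.

Lemma annihilatorP W b :
  annihilator W (sub_val b) <-> forall Phi, W Phi -> pairing b Phi = 0.
Proof.
split=> [[c E Hc]|Hb]; last by exists b.
by have -> : b = c by apply: val_inj.
Qed.

(** The annihilator is the common kernel of a finite spanning list of [W], so [common_kernel_span]
    applies. *)
Lemma annihilator_bidual W Psi : finite_dimensional W ->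
  (forall b, annihilator W (sub_val b) -> pairing b Psi = 0) -> W Psi.
Proof.
case=> s Ws H; rewrite Ws; apply: common_kernel_span => b bs.
apply/H/annihilatorP => Phi; rewrite Ws.
elim=> [|a x y xs _ IH]; first exact: linear0.
by rewrite linearP /= IH bs // scaler0 addr0.
Qed.

Lemma annihilator_homogeneous W b :
  (forall r Phi, W Phi -> Z2_deg r Phi -> pairing b Phi = 0) ->
  annihilator W (sub_val b).
Proof.
move=> H; apply/annihilatorP => Phi /gsub_graded [N [Psi [HPsi ->]]].
rewrite linear_sum big1 // => i _.
by case: (HPsi i) => WPsi DPsi; apply: H DPsi.
Qed.

(** A form of degree [r] sees only the component of degree [r]: it kills [c i] if [r] differs from
    [i], and otherwise takes the same value on [c i] as on the whole sum. *)
Lemma annihilator_component W N (c : nat -> Bmod U) (i : 'I_N) :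
  (forall j, B_deg j (c j)) -> annihilator W (sub_val (\sum_(j < N) c j)) ->
  annihilator W (sub_val (c i)).
Proof.
move=> Dc /annihilatorP Wc; apply: annihilator_homogeneous => r Phi WPhi DPhi.
have [Er|/eqP ne] := eqVneq (i : nat) r; last by apply: DPhi ne (Dc i).
have := Wc _ WPhi; rewrite pairing_sum (bigD1 i) //= big1 ?addr0 // => j ne_ji.
by apply: DPhi (Dc j); rewrite -Er => /val_inj /eqP; rewrite (negbTE ne_ji).
Qed.

(** Lie degree [n.+3] is internal degree [n.+1], the first one above the degree of [Phi]. *)
Lemma pairing_fil n b Phi : M_fil U n.+3 (sub_val b) -> Z2_deg n Phi -> pairing b Phi = 0.
Proof.
move=> Fb DPhi.
(* The span lives in [M(U)] and the pairing in [B(U)], so the induction runs over the image in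
   [M(U)] of the kernel of [Phi]. *)
have S0 : exists2 c, 0 = sub_val c & pairing c Phi = 0.
  by exists 0; [|apply: pairing0].
have SL a x y : (exists2 c, x = sub_val c & pairing c Phi = 0) ->
    (exists2 c, y = sub_val c & pairing c Phi = 0) ->
    exists2 c, a *: x + y = sub_val c & pairing c Phi = 0.
  move=> [c -> Ec] [d -> Ed]; exists (a *: c + d) => //.
  by rewrite pairing_linear Ec Ed scaler0 addr0.
have sub_S : M_fil U n.+3 `<=` Submodule S0 SL.
  apply: lin_span_ind => x [m le_m Dx].
  case: m le_m Dx => [|[|m]] // le_m Dx; have [c Dc ->] := B_degP Dx.
  by exists c => //; apply: DPhi Dc => E; rewrite E ltnn in le_m.
by have [c /val_inj ->] := sub_S _ Fb.
Qed.

End Duality.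

(** The annihilator lies in [M(U)'], which [M_proj] kills, so the projection to [U] factors through
    the quotient. *)
Lemma g_lie_proj (k : fieldType) (U : vectType k) (W : graded_submodule U) :
  exists pr : lieHom (g_lie W) (abelian_lie U),
    forall x, pr (lie_pi (annihilator W) x) = M_proj U x.
Proof.
have kills x : annihilator W x -> M_proj U x = 0.
  by case=> b -> _; apply: abelian_hom_derived; apply: sub_valP.
by exists (quot_lift kills) => x; apply: quot_lift_pi.
Qed.

Lemma pullback_cancel (k : fieldType) (U U' : vectType k) (P : {linear U -> U'})
    (Q : {linear U' -> U}) : cancel P Q -> cancel (pullback Q) (pullback P).
Proof.
move=> PK Phi; apply: pairing_ext => b.
rewrite -[LHS]/(pairing (B_map Q (B_map P b)) Phi); congr pairing.
by apply: val_inj; apply: (M_map_cancel PK).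
Qed.

(** * Comparison of leading terms *)

Section LeadingTerm.
Variables (k : fieldType) (U U' : vectType k).
Variables (W : graded_submodule U) (W' : graded_submodule U').

Variables (F : lieHom (Mlie U) (g_lie W')) (P : {linear U -> U'}).
Hypothesis F_gen : forall u, exists2 c, Mlie' U' c &
  F (M_gen u) = lie_pi (annihilator W') (M_gen (P u) + c).

(** On generators the error lies in [M(U')'], hence in level 2; brackets and linear combinations
    propagate the estimate. *)
Lemma leading_term n x : M_deg n x -> exists2 y, M_fil U' n.+1 y &
  F x = lie_pi (annihilator W') (M_map P x + y).
Proof.
case=> y Dy <-{x}; elim: Dy => {n y} [u|m n x y Dx [x' Fx' Ex] Dy [y' Fy' Ey]|n|].
- have [c /M'_fil Fc E] := F_gen u; exists c => //.
  by rewrite M_map_gen.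
- have Mx : M_fil U' m (M_map P (lie_pi _ x)).
    by apply: (@M_fil_deg _ _ m m) => //; apply: M_map_deg; exists x.
  have My : M_fil U' n (M_map P (lie_pi _ y)).
    by apply: (@M_fil_deg _ _ n n) => //; apply: M_map_deg; exists y.
  have Fy : M_fil U' n (M_map P (lie_pi _ y) + y').
    apply: subD => //; move: Fy'; apply: lin_span_ind => w [j lt_nj Dw].
    by apply: M_fil_deg Dw; apply: ltnW.
  (* The difference between the bracket of the two perturbed terms and that of their leading terms;
     each summand contains a factor one level higher. *)
  exists ([lie M_map P (lie_pi _ x), y'] + [lie x', M_map P (lie_pi _ y) + y']).
    apply: subD; first by rewrite -addnS; apply: M_fil_bracket.
    by rewrite -addSn; apply: M_fil_bracket.
  rewrite (lie_fun_bracket (lie_pi _)) (lie_fun_bracket F) Ex Ey.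
  rewrite -(lie_fun_bracket (lie_pi (annihilator W'))) (lie_fun_bracket (M_map P)).
  congr (lie_pi _ _).
  by rewrite addrA -bracketDr -bracketDl.
- by exists 0; [apply: sub0 | rewrite !linear0 addr0 linear0].
- move=> n a x y Dx [x' Fx' Ex] Dy [y' Fy' Ey].
  exists (a *: x' + y'); first exact: sub_lin.
  rewrite (lie_fun_linear (lie_pi _)) (lie_fun_linear F) Ex Ey.
  rewrite -(lie_fun_linear (lie_pi (annihilator W'))) (lie_fun_linear (M_map P)).
  rewrite scalerDr; congr (lie_pi _ _).
  by rewrite addrACA.
Qed.

Lemma M_map_annihilator :
  (forall x, annihilator W x -> F x = 0) ->
  forall b, annihilator W (sub_val b) -> annihilator W' (sub_val (B_map P b)).
Proof.
move=> F0 b; have [N [c [Dc ->]]] := B_homogeneous_sum b => Wc.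
rewrite linear_sum; apply: annihilator_homogeneous => r Phi WPhi DPhi.
rewrite pairing_sum big1 // => i _.
have [y Fy] := leading_term (Dc i); rewrite F0; last exact: annihilator_component.
(* [d] is the element of [W'^perp] with leading term [B_map P (c i)] and tail [y]. *)
move=> /esym/(proj1 (lie_pi_eq0 _ _)) [d Ed Wd].
have [Er|/eqP ne] := eqVneq (i : nat) r; last first.
  by apply: DPhi ne _; apply: M_map_deg (Dc i).
(* So the tail belongs to [B(U')], and [Phi], of degree [i], cannot see it: [Phi] vanishes on the
   leading term because it vanishes on [d]. *)
have Ez : sub_val (d - B_map P (c i)) = y by rewrite /= -Ed addrC addKr.
have := Wd _ WPhi; rewrite -[d](subrK (B_map P (c i))) pairingD.
by rewrite (@pairing_fil _ _ r) ?add0r // Ez -Er.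
Qed.

(** The pullback is adjoint to [B_map P], so [M_map_annihilator] makes it vanish on [W^perp]; the
    biannihilator property concludes. *)
Lemma pullback_sub : finite_dimensional W ->
  (forall x, annihilator W x -> F x = 0) ->
  forall Phi, W' Phi -> W (pullback P Phi).
Proof.
move=> finW F0 Phi WPhi; apply: annihilator_bidual => // b Wb.
by have /annihilatorP := M_map_annihilator F0 Wb; apply.
Qed.

End LeadingTerm.

(** * The linear isomorphism induced by a Lie isomorphism *)

Section Abelianization.
Variable k : fieldType.

(** Stated with lifts to [M(U')], in the form that the comparison of leading terms takes as its
    hypothesis. *)
Definition abelianizes_to (U U' : vectType k) (W : graded_submodule U)
    (W' : graded_submodule U') (f : lieHom (g_lie W) (g_lie W')) (P : U -> U') :=
  forall u, exists2 c, Mlie' U' c &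
    f (lie_pi _ (M_gen u)) = lie_pi (annihilator W') (M_gen (P u) + c).

Lemma abelianization_exists (U U' : vectType k) (W : graded_submodule U)
    (W' : graded_submodule U') (f : lieHom (g_lie W) (g_lie W')) :
  exists P : {linear U -> U'}, abelianizes_to f P.
Proof.
have [pr prE] := g_lie_proj W'.
(* The composite of [U -> g_W], [f] and the projection [g_W' -> U']. *)
pose p (u : U) : U' := pr (f (lie_pi _ (M_gen u))).
have p_linear : linear p by move=> a u v; rewrite /p !linearP.
pose P : {linear U -> U'} := HB.pack p (GRing.isLinear.Build _ _ _ _ _ p_linear).
exists P => u; have [z Ez] := @lie_pi_surj k _ (annihilator W') (f (lie_pi _ (M_gen u))).
rewrite -[P u]/(p u) /p Ez prE.
have [v Dv] := M_decomp z; exists (z - M_gen v) => //.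
suff -> : M_proj U' z = v by rewrite addrC subrK.
have -> : M_proj U' z = M_proj U' (z - M_gen v) + M_proj U' (M_gen v).
  by rewrite -linearD subrK.
by rewrite M_proj_gen (abelian_hom_derived (M_proj U') Dv) add0r.
Qed.

(** Project [g (f u) = u] to [U]: both error terms lie in derived ideals, which homomorphisms
    preserve and the projection kills. *)
Lemma abelianization_cancel (U U' : vectType k) (W : graded_submodule U)
    (W' : graded_submodule U') (f : lieHom (g_lie W) (g_lie W'))
    (g : lieHom (g_lie W') (g_lie W)) (P : U -> U') (Q : U' -> U) :
  abelianizes_to f P -> abelianizes_to g Q -> cancel f g -> cancel P Q.
Proof.
move=> fP gQ fK u; have [pr prE] := g_lie_proj W.
have [c Dc Ec] := fP u; have [d Dd Ed] := gQ (P u).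
have prD x : Mlie' U' x -> pr (g (lie_pi _ x)) = 0.
  by move=> Dx; apply: abelian_hom_derived; do 2! apply: lie_hom_derived.
have := congr1 pr (fK (lie_pi _ (M_gen u))).
rewrite Ec !linearD /= Ed !linearD /= !prE !M_proj_gen prD // addr0.
by rewrite (abelian_hom_derived (M_proj U) Dd) addr0.
Qed.

Lemma g_lie_iso_pullback (U U' : vectType k) (W : graded_submodule U)
    (W' : graded_submodule U') :
  finite_dimensional W -> finite_dimensional W' ->
  lie_isomorphic (g_lie W) (g_lie W') ->
  exists P : {linear U -> U'}, bijective P /\ pullback P @` W' = W :> set (Z2 U).
Proof.
move=> finW finW' [f /lie_hom_inverse[g [fK gK]]].
have [P fP] := abelianization_exists f; have [Q gQ] := abelianization_exists g.
have PK := abelianization_cancel fP gQ fK; have QK := abelianization_cancel gQ fP gK.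
have killed (V V' : vectType k) (X : graded_submodule V) (X' : graded_submodule V')
    (h : lieHom (g_lie X) (g_lie X')) x :
    annihilator X x -> lie_comp h (lie_pi (annihilator X)) x = 0.
  by move=> /lie_pi_eq0 E; rewrite -[LHS]/(h (lie_pi _ x)) E linear0.
exists P; split; first by exists Q.
have subW := @pullback_sub _ _ _ W W' (lie_comp f (lie_pi _)) P fP finW (killed _ _ _ _ f).
have subW' := @pullback_sub _ _ _ W' W (lie_comp g (lie_pi _)) Q gQ finW' (killed _ _ _ _ g).
apply/seteqP; split=> [_ [Phi WPhi <-]|Phi WPhi]; first exact: subW.
(* The inverse gives [Q^* W] inside [W'], and [P^*] undoes [Q^*]. *)
by exists (pullback Q Phi); [apply: subW' | apply: pullback_cancel].
Qed.

End Abelianization.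

(** * From a linear isomorphism back to a graded Lie isomorphism *)

Lemma pullback_graded_iso (k : fieldType) (U U' : vectType k)
    (W : graded_submodule U) (W' : graded_submodule U') (P : {linear U -> U'}) :
  bijective P -> pullback P @` W' = W :> set (Z2 U) ->
  graded_lie_isomorphic (@g_deg k U W) (@g_deg k U' W').
Proof.
case=> q PK QK PW.
have q_linear : linear q by exact: can2_linear PK QK.
pose Q : {linear U' -> U} := HB.pack q (GRing.isLinear.Build _ _ _ _ _ q_linear).
have PK' : cancel P Q := PK; have QK' : cancel Q P := QK.
(* The inclusion of [P^* W'] in [W] lets [M_map P] descend to the quotients. *)
have killP x : annihilator W x -> lie_comp (lie_pi (annihilator W')) (M_map P) x = 0.
  move=> [b -> Wb]; apply/lie_pi_eq0/(annihilatorP W' (B_map P b)) => Phi WPhi.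
  by apply: (Wb (pullback P Phi)); rewrite -PW; exists Phi.
(* The reverse inclusion does the same for [M_map Q]: each form in [W] is some [P^* Psi], and [Q^*]
   returns it to [Psi]. *)
have killQ x : annihilator W' x -> lie_comp (lie_pi (annihilator W)) (M_map Q) x = 0.
  move=> [b -> Wb]; apply/lie_pi_eq0/(annihilatorP W (B_map Q b)) => Phi.
  rewrite -PW => -[Psi WPsi <-]; rewrite -(Wb _ WPsi).
  by rewrite -[in RHS](pullback_cancel QK' Psi).
have PiE := quot_lift_pi killP; have QiE := quot_lift_pi killQ.
exists (quot_lift killP); split.
  exists (quot_lift killQ) => x; case: (lie_pi_surj x) => y ->.
    rewrite (PiE y : quot_lift killP _ = lie_pi _ (M_map P y)).
    exact: etrans (QiE _) (congr1 (lie_pi _) (M_map_cancel PK' y)).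
  rewrite (QiE y : quot_lift killQ _ = lie_pi _ (M_map Q y)).
  exact: etrans (PiE _) (congr1 (lie_pi _) (M_map_cancel QK' y)).
move=> n; apply/seteqP; split=> [_ [_ [x Dx <-] <-]|_ [x Dx <-]].
  by exists (M_map P x); [apply: M_map_deg | exact: esym (PiE x)].
exists (lie_pi _ (M_map Q x)); first by exists (M_map Q x) => //; apply: M_map_deg.
exact: etrans (PiE _) (congr1 (lie_pi _) (M_map_cancel QK' x)).
Qed.

Theorem corollary3p4 (k : fieldType) (char0 : [pchar k] =i pred0)
    (U U' : vectType k)
    (W : graded_submodule U) (finW : finite_dimensional W)
    (W' : graded_submodule U') (finW' : finite_dimensional W') :
  (lie_isomorphic (g_lie W) (g_lie W') <->
   graded_lie_isomorphic (@g_deg k U W) (@g_deg k U' W')) /\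
  (graded_lie_isomorphic (@g_deg k U W) (@g_deg k U' W') <->
   exists P : {linear U -> U'},
     bijective P /\ pullback P @` W' = W :> set (Z2 U)).
Proof.
(* The equivalences follow from the cycle (ii) to (i) to (iii) to (ii). *)
have graded_iso : graded_lie_isomorphic (@g_deg k U W) (@g_deg k U' W') ->
    lie_isomorphic (g_lie W) (g_lie W').
  by case=> f [bij_f _]; exists f.
have iso_pullback := g_lie_iso_pullback finW finW'.
have iso_graded : (exists P : {linear U -> U'},
    bijective P /\ pullback P @` W' = W :> set (Z2 U)) ->
    graded_lie_isomorphic (@g_deg k U W) (@g_deg k U' W').
  by case=> P [bij_P PW]; apply: pullback_graded_iso bij_P PW.
by do 2 split=> //; [move=> /iso_pullback/iso_graded | move=> /graded_iso/iso_pullback].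
Qed.
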